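(* Let $\alpha,\beta\ge0$, $\alpha_1\le\alpha_2$, $\beta_1\le\beta_2$ be real numbers, $\textbf{w}=(w_j)_j\in\mathcal{W}^{\alpha}_{\alpha_1,\alpha_2}$, $\textbf{v}=(v_j)_j\in\mathcal{W}^{\beta}_{\beta_1,\beta_2}$, $p,q_0,q_1\in\mathcal{P}(\mathbb{R}^n)$, and define $q^\ast\in(0,\infty]$ by $$\frac1{q^\ast}:=\Big(\frac1{q_1^-}-\frac1{q_0^+}\Big)_+.$$ If $\big(\frac{v_j}{w_j}\big)_j\in\ell_{q^\ast}(L_\infty)$, then $B^{\textbf{w}}_{p(\cdot),q_0(\cdot)}\hookrightarrow B^{\textbf{v}}_{p(\cdot),q_1(\cdot)}$. If $\big(\frac{v_j}{w_j}\big)_j\in L_\infty(\ell_{q^\ast})$ and $p^+,q_0^+,q_1^+<\infty$, then $F^{\textbf{w}}_{p(\cdot),q_0(\cdot)}\hookrightarrow F^{\textbf{v}}_{p(\cdot),q_1(\cdot)}$.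
   Context: Conventions. $\hookrightarrow$ denotes continuous embedding; $r_+:=\max\{r,0\}$; $1/\infty=0$ and $q^\ast=\infty$ if $1/q^\ast=0$. $\ell_{r}(L_\infty)$ consists of sequences $(f_j)_{j\in\mathbb{N}_0}$ with $\big\|(\|f_j\,|\,L_\infty\|)_j\,|\,\ell_r\big\|<\infty$, and $L_\infty(\ell_r)$ of those with $\operatorname{ess\,sup}_x\|(f_j(x))_j\,|\,\ell_r\|<\infty$. $\mathcal{S}$ is the Schwartz space on $\mathbb{R}^n$, $\mathcal{S}'$ the tempered distributions, $\hat f$ the Fourier transform (for $f\in\mathcal{S}$: $\hat f(\xi)=(2\pi)^{-n/2}\int e^{-ix\cdot\xi}f(x)\,dx$). Variable exponents and spaces. $\mathcal{P}(\mathbb{R}^n)$ is the set of measurable $p:\mathbb{R}^n\to(0,\infty]$ with $p^-:=\operatorname{ess\,inf} p>0$; $p^+:=\operatorname{ess\,sup}p$. Let $\phi_p(t)=t^p$ for $p\in(0,\infty)$, and $\phi_\infty(t)=0$ for $t\in[0,1]$, $\phi_\infty(t)=\infty$ for $t>1$. Put $\varrho_{p(\cdot)}(f)=\int_{\mathbb{R}^n}\phi_{p(x)}(|f(x)|)\,dx$ and $\|f\,|\,L_{p(\cdot)}\|=\inf\{\lambda>0:\varrho_{p(\cdot)}(f/\lambda)\le1\}$ ($\inf\varnothing=\infty$). For sequences $(f_\nu)_{\nu\in\mathbb{N}_0}$ of measurable functions: $\|(f_\nu)_\nu\,|\,L_{p(\cdot)}(\ell_{q(\cdot)})\|:=\big\|\,\|(f_\nu(x))_\nu\,|\,\ell_{q(x)}\|\,\big|\,L_{p(\cdot)}\big\|$;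 and $\|(f_\nu)_\nu\,|\,\ell_{q(\cdot)}(L_{p(\cdot)})\|:=\inf\{\mu>0:\varrho_{\ell_{q(\cdot)}(L_{p(\cdot)})}(\tfrac1\mu(f_\nu)_\nu)\le1\}$, where $\varrho_{\ell_{q(\cdot)}(L_{p(\cdot)})}((f_\nu)_\nu):=\sum_\nu\inf\{\lambda_\nu>0:\varrho_{p(\cdot)}(f_\nu/\lambda_\nu^{1/q(\cdot)})\le1\}$ (with $\lambda^{1/\infty}=1$). Weights. $\textbf{w}=(w_j)_{j\in\mathbb{N}_0}\in\mathcal{W}^{\alpha}_{\alpha_1,\alpha_2}$ means that the $w_j$ are positive measurable functions on $\mathbb{R}^n$ such that (i) for some $c>0$, $0<w_j(x)\le c\,w_j(y)(1+2^j|x-y|)^\alpha$ for all $j\in\mathbb{N}_0$, $x,y\in\mathbb{R}^n$; (ii) $2^{\alpha_1}w_j(x)\le w_{j+1}(x)\le2^{\alpha_2}w_j(x)$ for all $j\in\mathbb{N}_0$, $x\in\mathbb{R}^n$. Admissible pairs and function spaces. A pair $(\varphi,\Phi)$ in $\mathcal{S}$ is admissible if $\operatorname{supp}\hat\varphi\subset\{\frac12\le|\xi|\le2\}$ and $|\hat\varphi(\xi)|\ge c>0$ for $\frac35\le|\xi|\le\frac53$, and $\operatorname{supp}\hat\Phi\subset\{|\xi|\le2\}$ and $|\hat\Phi(\xi)|\ge c>0$ for $|\xi|\le\frac53$. Put $\varphi_0:=\Phi$, $\varphi_j:=2^{jn}\varphi(2^j\cdot)$ for $j\in\mathbb{N}$.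 $B^{\textbf{w}}_{p(\cdot),q(\cdot)}$ is the set of $f\in\mathcal{S}'$ with $\|f\,|\,B^{\textbf{w}}_{p(\cdot),q(\cdot)}\|:=\|(w_j(\varphi_j\ast f))_j\,|\,\ell_{q(\cdot)}(L_{p(\cdot)})\|<\infty$ and, for $p^+,q^+<\infty$, $F^{\textbf{w}}_{p(\cdot),q(\cdot)}$ is the set of $f\in\mathcal{S}'$ with $\|f\,|\,F^{\textbf{w}}_{p(\cdot),q(\cdot)}\|:=\|(w_j(\varphi_j\ast f))_j\,|\,L_{p(\cdot)}(\ell_{q(\cdot)})\|<\infty$. Since no log-Hölder regularity of the exponents is assumed, the embeddings are understood with one and the same fixed system $\{\varphi_j\}$ used to define all spaces involved. *)

(* Defs.v *)
From HB Require Import structures.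
From mathcomp Require Import all_boot all_order all_algebra.
From mathcomp Require Import all_classical all_reals all_analysis.
From mathcomp Require Import measurable_realfun ess_sup_inf.
From mathcomp.real_closed Require Import complex.
From mathcomp Require Import ring lra.

Set Implicit Arguments.
Unset Strict Implicit.
Unset Printing Implicit Defensive.
Import Order.TTheory GRing.Theory Num.Theory.
Import numFieldNormedType.Exports Normc.

Local Open Scope classical_set_scope.
Local Open Scope ring_scope.
Local Open Scope complex_scope.

Section lebesgue.
Context (R : realType).

Definition cons_tuple n (z : n.-tuple (measurableTypeR R) * measurableTypeR R) :
  n.+1.-tuple (measurableTypeR R) := [tuple of z.2 :: z.1].

Lemma measurable_cons_tuple n : measurable_fun setT (@cons_tuple n).
Proof. exact: measurable_cons. Qed.

Section step.
Variables (n : nat) (m : {measure set (n.-tuple (measurableTypeR R)) -> \bar R}).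

Definition lebesgue_tupleS : set (n.+1.-tuple (measurableTypeR R)) -> \bar R :=
  pushforward (m \x lebesgue_measure)%E (@cons_tuple n).

HB.instance Definition _ := Measure.copy lebesgue_tupleS
  (measure_function_pushforward__canonical__measure_function_Measure
     (m \x lebesgue_measure)%E (@measurable_cons_tuple n)).

End step.

Fixpoint lebesgue_tuple n :
    {measure set (n.-tuple (measurableTypeR R)) -> \bar R} :=
  match n with
  | 0 => dirac [tuple]
  | m.+1 => lebesgue_tupleS (lebesgue_tuple m)
  end.

Variable n : nat.

Definition tuple_of_row (x : 'rV[R]_n) : n.-tuple (measurableTypeR R) :=
  [tuple x ord0 i | i < n].

Definition row_of_tuple (t : n.-tuple (measurableTypeR R)) : 'rV[R]_n :=
  \row_i tnth t i.

Definition borel_row := g_sigma_algebra_preimageType tuple_of_row.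

Lemma row_of_tupleK : cancel row_of_tuple tuple_of_row.
Proof. by move=> t; apply/eq_from_tnth => i; rewrite tnth_mktuple mxE. Qed.

Lemma measurable_row_of_tuple :
  measurable_fun setT (row_of_tuple : _ -> borel_row).
Proof.
move=> _ _ [B mB <-]; rewrite !setTI -comp_preimage.
by rewrite (_ : _ \o _ = id) ?preimage_id//; apply/funext/row_of_tupleK.
Qed.

Definition lebesgue_borel : set borel_row -> \bar R :=
  pushforward (lebesgue_tuple n) (row_of_tuple : _ -> borel_row).

HB.instance Definition _ := Measure.copy lebesgue_borel
  (measure_function_pushforward__canonical__measure_function_Measure
     (lebesgue_tuple n) measurable_row_of_tuple).

(* Its measurable sets are the Lebesgue measurable ones: the Caratheodory
   extension below completes the Borel measure. *)
Definition Rn : Type := 'rV[R]_n.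

HB.instance Definition _ := Pointed.copy Rn 'rV[R]_n.

HB.instance Definition _ := @isMeasurable.Build default_measure_display Rn
  (lebesgue_borel^*)%mu.-caratheodory
  (@caratheodory_measurable_set0 _ _ (lebesgue_borel^*)%mu)
  (@caratheodory_measurable_setC _ _ (lebesgue_borel^*)%mu)
  (@caratheodory_measurable_bigcup _ _ (lebesgue_borel^*)%mu).

Definition lebesgue : set Rn -> \bar R := (lebesgue_borel^*)%mu.

HB.instance Definition _ := isMeasure.Build _ Rn R lebesgue
  (caratheodory_measure0 (lebesgue_borel^*)%mu)
  (@caratheodory_measure_ge0 _ _ (lebesgue_borel^*)%mu)
  (@caratheodory_measure_sigma_additive _ _ (lebesgue_borel^*)%mu).

End lebesgue.
Arguments Rn : clear implicits.
Arguments lebesgue : clear implicits.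

Section schwartz.
Context (R : realType) (n : nat).
Implicit Types (f g : 'rV[R]_n -> R) (F G : 'rV[R]_n -> R[i]).

Definition pderive (s : seq 'I_n) f : 'rV[R]_n -> R :=
  foldr (fun i g => 'D_(delta_mx 0 i) g) f s.

Definition smooth f := forall s, continuous (pderive s f) /\
  forall i x, derivable (pderive s f) x (delta_mx 0 i).

Definition cpderive s F : 'rV[R]_n -> R[i] := fun x =>
  pderive s (@complex.Re R \o F) x +i* pderive s (@complex.Im R \o F) x.

(* `|x| is the maximum norm here; every norm of R^n yields the same space and
   the same topology. *)
Definition seminorm (N : nat) s F : \bar R :=
  ereal_sup [set ((1 + `|x|) ^+ N * normc (cpderive s F x))%:E | x in setT].

Definition is_schwartz F := [/\ smooth (@complex.Re R \o F), smooth (@complex.Im R \o F) &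
  forall N s, (seminorm N s F < +oo)%E].

Lemma is_schwartz_bound F : is_schwartz F <->
  [/\ smooth (@complex.Re R \o F), smooth (@complex.Im R \o F) & forall N s, exists M : R,
   forall x, (1 + `|x|) ^+ N * normc (cpderive s F x) <= M].
Proof.
split=> -[sR sI sF]; split=> // N s; last first.
  have [M HM] := sF N s.
  apply: (@le_lt_trans _ _ M%:E); last exact: ltry.
  by apply: ge_ereal_sup => _ [x _ <-]; rewrite lee_fin.
have := sF N s.
set S := seminorm N s F => Soo.
have HS x : (((1 + `|x|) ^+ N * normc (cpderive s F x))%:E <= S)%E.
  by apply: ereal_sup_ubound; exists x.
have Sfin : S \is a fin_num.
  rewrite fin_numElt Soo andbT (lt_le_trans _ (HS 0))// ltNyr//.
by exists (fine S) => x; rewrite -lee_fin fineK.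
Qed.

Lemma pderive_lin f g (a b : R) : smooth f -> smooth g -> forall s,
  pderive s (fun x => a * f x + b * g x) =
  (fun x => a * pderive s f x + b * pderive s g x).
Proof.
move=> sf sg; elim=> //= i s ->; apply/funext => x.
have [_ /(_ i x) df] := sf s; have [_ /(_ i x) dg] := sg s.
rewrite (_ : (fun x => _) = (a \*: pderive s f) + (b \*: pderive s g))//.
by rewrite deriveD ?deriveZ//; apply: derivableZ.
Qed.

Lemma smooth_lin f g (a b : R) : smooth f -> smooth g ->
  smooth (fun x => a * f x + b * g x).
Proof.
move=> sf sg s; rewrite pderive_lin//; split=> [x|i x].
  have [/(_ x) cf _] := sf s; have [/(_ x) cg _] := sg s.
  apply: (@continuousD _ _ _ (a \*: pderive s f) (b \*: pderive s g)).
    exact: continuousZl_tmp.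
  exact: continuousZl_tmp.
have [_ /(_ i x) df] := sf s; have [_ /(_ i x) dg] := sg s.
rewrite (_ : (fun x => _) = (a \*: pderive s f) + (b \*: pderive s g))//.
by apply: derivableD; apply: derivableZ.
Qed.

Lemma cvg_mul_dnbhs0 (c : R) : c != 0 -> c * h @[h --> 0^'] --> 0^'.
Proof.
move=> c0 A /= [e e0 eA]; have c0' : 0 < `|c| by rewrite normr_gt0.
exists (e / `|c|); first by rewrite /= divr_gt0.
move=> h; rewrite /ball /= sub0r normrN ltr_pdivlMr// => he h0.
apply: eA; last by rewrite mulf_neq0.
by rewrite /ball /= sub0r normrN normrM mulrC.
Qed.

Lemma is_derive_affine g (c : R) (b x v : 'rV[R]_n) : c != 0 ->
  derivable g (c *: x + b) v ->
  is_derive x v (fun y => g (c *: y + b)) (c * 'D_v g (c *: x + b)).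
Proof.
move=> c0 dg; set a := c *: x + b.
pose q (h : R) := h^-1 *: (g (h *: v + a) - g a).
have qD : q h @[h --> 0^'] --> 'D_v g a by exact: dg.
set p := fun h : R => h^-1 *: (g (c *: (h *: v + x) + b) - g a).
have pE : p = (fun h => c * q (c * h)).
  have scaleE (k t : R) : k *: t = k * t by [].
  apply/funext => h; rewrite /p /q.
  rewrite (_ : c *: (h *: v + x) + b = (c * h) *: v + a); last first.
    by rewrite /a scalerDr scalerA addrA.
  by rewrite !scaleE invfM !mulrA divff// mul1r.
have pD : p h @[h --> 0^'] --> c * 'D_v g a.
  rewrite pE; apply: cvgMl_tmp.
  exact: (cvg_comp _ _ (cvg_mul_dnbhs0 c0) qD).
apply: DeriveDef; first by apply/cvg_ex; exists (c * 'D_v g a).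
exact: cvg_lim pD.
Qed.

Lemma pderive_affine f (c : R) (b : 'rV[R]_n) : c != 0 -> smooth f ->
  forall s, pderive s (fun y => f (c *: y + b)) =
            (fun y => c ^+ size s * pderive s f (c *: y + b)).
Proof.
move=> c0 sf; elim=> [|i s /= ->]; first by apply/funext=> y; rewrite mul1r.
apply/funext => x; have [_ /(_ i (c *: x + b)) df] := sf s.
have D := is_derive_affine c0 df.
rewrite (_ : (fun y => _) =
  c ^+ size s \*: (fun y => pderive s f (c *: y + b)))//.
by rewrite deriveZ// derive_val exprSr -mulrA.
Qed.

Lemma smooth_affine f (c : R) (b : 'rV[R]_n) : c != 0 -> smooth f ->
  smooth (fun y => f (c *: y + b)).
Proof.
move=> c0 sf s; rewrite pderive_affine//; split=> [x|i x].
  have [cf _] := sf s.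
  rewrite (_ : (fun y => _) =
    c ^+ size s \*: (fun y => pderive s f (c *: y + b)))//.
  apply: continuousZl_tmp.
  have cA : {for x, continuous (fun y : 'rV[R]_n => c *: y + b)}.
    apply: (@continuousD _ _ _ ( *:%R c) (cst b)); last exact: cst_continuous.
    exact: scaler_continuous.
  exact: (@continuous_comp 'rV[R]_n 'rV[R]_n R _ _ x cA (cf _)).
have [_ /(_ i (c *: x + b)) df] := sf s.
have D := is_derive_affine c0 df.
rewrite (_ : (fun y => _) =
  c ^+ size s \*: (fun y => pderive s f (c *: y + b)))//.
Qed.

Lemma normc_ge0 (z : R[i]) : 0 <= normc z.
Proof. by case: z => a b; exact: sqrtr_ge0. Qed.

Definition csmooth F := smooth (@complex.Re R \o F) /\ smooth (@complex.Im R \o F).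

Lemma re_lin (a : R[i]) F G : @complex.Re R \o (a *: F + G) = fun x =>
  1 * (complex.Re a * complex.Re (F x) + (- complex.Im a) * complex.Im (F x))
  + 1 * complex.Re (G x).
Proof.
apply/funext => x; rewrite /comp (_ : (_ + _) x = a * F x + G x)//.
by case: a (F x) (G x) => [a1 a2] [f1 f2] [g1 g2] /=; ring.
Qed.

Lemma im_lin (a : R[i]) F G : @complex.Im R \o (a *: F + G) = fun x =>
  1 * (complex.Re a * complex.Im (F x) + complex.Im a * complex.Re (F x))
  + 1 * complex.Im (G x).
Proof.
apply/funext => x; rewrite /comp (_ : (_ + _) x = a * F x + G x)//.
by case: a (F x) (G x) => [a1 a2] [f1 f2] [g1 g2] /=; ring.
Qed.

Lemma csmooth_lin (a : R[i]) F G : csmooth F -> csmooth G ->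
  csmooth (a *: F + G).
Proof.
move=> [rF iF] [rG iG]; split; [rewrite re_lin|rewrite im_lin];
  by apply: smooth_lin => //; apply: smooth_lin.
Qed.

Lemma cpderive_lin (a : R[i]) F G s : csmooth F -> csmooth G ->
  cpderive s (a *: F + G) = fun x => a * cpderive s F x + cpderive s G x.
Proof.
move=> [rF iF] [rG iG]; apply/funext => x; rewrite /cpderive re_lin im_lin.
rewrite (pderive_lin 1 1 (smooth_lin _ _ rF iF) rG) (pderive_lin _ _ rF iF).
rewrite (pderive_lin 1 1 (smooth_lin _ _ iF rF) iG) (pderive_lin _ _ iF rF).
by case: a => a1 a2; apply/eqP; rewrite eq_complex /=; apply/andP; split;
  apply/eqP; ring.
Qed.

Lemma is_schwartz_lin (a : R[i]) F G : is_schwartz F -> is_schwartz G ->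
  is_schwartz (a *: F + G).
Proof.
move=> /is_schwartz_bound[rF iF bF] /is_schwartz_bound[rG iG bG].
have [rH iH] := csmooth_lin a (conj rF iF) (conj rG iG).
apply/is_schwartz_bound; split=> // N s.
have [[MF HF] [MG HG]] := (bF N s, bG N s).
exists (normc a * MF + MG) => x.
rewrite (cpderive_lin _ _ (conj rF iF) (conj rG iG)).
have x0 : 0 <= (1 + `|x|) ^+ N by rewrite exprn_ge0// addr_ge0.
apply: (le_trans (ler_wpM2l x0 (le_normcD _ _))).
rewrite mulrDr normcM mulrCA lerD// ler_wpM2l//.
exact: normc_ge0.
Qed.

Lemma cpderive_affine F (c : R) (b : 'rV[R]_n) s : c != 0 -> csmooth F ->
  cpderive s (fun y => F (c *: y + b)) =
  fun y => (c ^+ size s)%:C * cpderive s F (c *: y + b).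
Proof.
move=> c0 [rF iF]; apply/funext => x; rewrite /cpderive.
rewrite (pderive_affine b c0 rF) (pderive_affine b c0 iF).
by apply/eqP; rewrite eq_complex /= !mul0r subr0 addr0 !eqxx.
Qed.

Lemma is_schwartz_affine F (c : R) (b : 'rV[R]_n) : c != 0 ->
  is_schwartz F -> is_schwartz (fun y => F (c *: y + b)).
Proof.
move=> c0 /is_schwartz_bound[rF iF bF]; apply/is_schwartz_bound.
split=> [| |N s]; [exact: (smooth_affine b c0 rF)|exact: (smooth_affine b c0 iF)|].
have [M HM] := bF N s.
pose K := 1 + `|c|^-1 * (1 + `|b|).
exists (`|c| ^+ size s * K ^+ N * M) => x.
rewrite (cpderive_affine _ _ c0 (conj rF iF)) normcM.
have -> : normc (c ^+ size s)%:C = `|c| ^+ size s.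
  by rewrite /normc /= expr0n /= addr0 sqrtr_sqr normrX.
rewrite mulrCA -mulrA ler_wpM2l ?exprn_ge0//.
have n0 : 0 <= normc (cpderive s F (c *: x + b)) by exact: normc_ge0.
have K0 : 0 <= K by rewrite addr_ge0// mulr_ge0// addr_ge0.
apply: (@le_trans _ _ (K ^+ N * ((1 + `|c *: x + b|) ^+ N *
  normc (cpderive s F (c *: x + b))))); last by rewrite ler_wpM2l// exprn_ge0.
rewrite mulrA ler_wpM2r// -exprMn lerXn2r ?nnegrE ?mulr_ge0 ?addr_ge0//.
have c0' : 0 < `|c| by rewrite normr_gt0.
have xle : `|x| <= `|c|^-1 * (`|c *: x + b| + `|b|).
  rewrite -(ler_pM2l c0') mulrA divff ?mul1r ?gt_eqF// -normrZ.
  by rewrite -{1}(addrK b (c *: x)) ler_normB.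
have ic : 0 <= `|c|^-1 by rewrite invr_ge0.
rewrite /K; move: xle ic (normr_ge0 (c *: x + b)) (normr_ge0 b).
move: `|x| `|c|^-1 `|c *: x + b| `|b| => X I A B xle ic A0 B0.
have h := mulr_ge0 (mulr_ge0 ic A0) B0; apply: (le_trans (y := 1 + I * (A + B))).
  by rewrite lerD2l.
rewrite (_ : (1 + I * (1 + B)) * (1 + A) = 1 + I * (A + B) + (A + I + I * A * B)); last by ring.
by rewrite lerDl !addr_ge0.
Qed.

Lemma is_schwartz0 : is_schwartz (0 : 'rV[R]_n -> R[i]).
Proof.
have E s : pderive s (fun=> 0 : R) = fun=> 0.
  elim: s => //= i s ->; apply/funext => x.
  exact: (@derive_cst R 'rV[R]_n R 0 x).
have S : smooth (fun=> 0 : R).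
  move=> s; rewrite E; split=> [|i x]; first exact: cst_continuous.
  exact: (@derivable_cst R 'rV[R]_n R 0 x).
apply/is_schwartz_bound; split=> // N s; exists 0 => x.
by rewrite /cpderive /comp /= !E /= expr0n /= addr0 sqrtr0 mulr0.
Qed.

Definition schwartz_pred : {pred 'rV[R]_n -> R[i]} := mem [set F | is_schwartz F].

Lemma schwartz_submod_closed : GRing.submod_closed schwartz_pred.
Proof.
split=> [|a F G]; rewrite !inE /=; first exact: is_schwartz0.
exact: is_schwartz_lin.
Qed.

HB.instance Definition _ := GRing.isSubmodClosed.Build R[i]
  ('rV[R]_n -> R[i]) schwartz_pred schwartz_submod_closed.

Record schwartz := Schwartz
  { schwartz_fun :> 'rV[R]_n -> R[i]; _ : schwartz_fun \in schwartz_pred }.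

HB.instance Definition _ := [isSub for schwartz_fun].
HB.instance Definition _ := [Choice of schwartz by <:].
HB.instance Definition _ := [SubChoice_isSubLmodule of schwartz by <:].

Lemma schwartzP (F : schwartz) : is_schwartz F.
Proof. by have := valP F; rewrite inE. Qed.

End schwartz.

Section distribution.
Context (R : realType) (n : nat).

(* Continuity for the locally convex topology given by the seminorms. *)
Definition schwartz_continuous (T : schwartz R n -> R[i]) :=
  forall (F : schwartz R n) (e : R), 0 < e ->
  exists (N : nat) (d : R), 0 < d /\
    forall G : schwartz R n,
      (forall k s, (k <= N)%N -> (size s <= N)%N ->
        (seminorm k s (G - F)%R < d%:E)%E) ->
      normc (T G - T F) < e.

Record tempered := Tempered {
  tempered_fun :> {scalar schwartz R n} ;
  tempered_continuous : schwartz_continuous tempered_fun }.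

Lemma schwartz_reflectP (F : schwartz R n) (x : 'rV[R]_n) :
  (fun y : 'rV[R]_n => F (x - y)) \in @schwartz_pred R n.
Proof.
rewrite inE/= (_ : (fun y => _) = fun y => F (-1 *: y + x)).
  by apply: is_schwartz_affine (schwartzP F); rewrite oppr_eq0 oner_neq0.
by apply/funext => y; rewrite scaleN1r addrC.
Qed.

Lemma schwartz_dilateP (F : schwartz R n) (j : nat) :
  (fun y : 'rV[R]_n => F (2 ^+ j *: y)) \in @schwartz_pred R n.
Proof.
rewrite inE/= (_ : (fun y => _) = fun y => F (2 ^+ j *: y + 0)).
  by apply: is_schwartz_affine (schwartzP F); rewrite expf_neq0 ?pnatr_eq0.
by apply/funext => y; rewrite addr0.
Qed.

Definition convolution (F : schwartz R n) (T : tempered) : 'rV[R]_n -> R[i] :=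
  fun x => T (Schwartz (schwartz_reflectP F x)).

Definition dot (x y : 'rV[R]_n) : R := \sum_i x ord0 i * y ord0 i.

(* The Euclidean norm: `|x| is the maximum norm on 'rV[R]_n. *)
Definition enorm (x : 'rV[R]_n) : R := Num.sqrt (dot x x).

Definition cintegral (F : 'rV[R]_n -> R[i]) : R[i] :=
  (\int[lebesgue R n]_x complex.Re (F x)) +i*
  (\int[lebesgue R n]_x complex.Im (F x)).

Definition fourier (F : 'rV[R]_n -> R[i]) (xi : 'rV[R]_n) : R[i] :=
  ((2 * pi) `^ (- (n%:R / 2)))%:C *
  cintegral (fun x => (cos (dot x xi) -i* sin (dot x xi)) * F x).

Definition support (F : 'rV[R]_n -> R[i]) := closure [set x | F x != 0].

Definition admissible (phi Phi : schwartz R n) :=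
  [/\ support (fourier phi) `<=` [set xi | 2^-1 <= enorm xi <= 2],
      exists2 c : R, 0 < c & forall xi, 3 / 5 <= enorm xi <= 5 / 3 ->
        c <= normc (fourier phi xi),
      support (fourier Phi) `<=` [set xi | enorm xi <= 2] &
      exists2 c : R, 0 < c & forall xi, enorm xi <= 5 / 3 ->
        c <= normc (fourier Phi xi)].

Definition dyadic (phi Phi : schwartz R n) (j : nat) : schwartz R n :=
  if j == 0%N then Phi
  else (2 ^+ (j * n))%:C *: Schwartz (schwartz_dilateP phi j).

End distribution.

Section exponent.
Context (R : realType) (n : nat).
Local Notation mu := (lebesgue R n).
Local Open Scope ereal_scope.
Implicit Types (p q : 'rV[R]_n -> \bar R) (f : nat -> 'rV[R]_n -> \bar R).

Definition exponent p :=
  [/\ measurable_fun [set: Rn R n] p, forall x, 0 < p x & 0 < ess_inf mu p].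

(* Exponents are positive, so the value at r = -oo is irrelevant. *)
Definition phi_exp (r t : \bar R) : \bar R :=
  match r with
  | s%:E => t `^ s
  | +oo => if t <= 1 then 0 else +oo
  | -oo => 0
  end.

Definition modular p (g : 'rV[R]_n -> \bar R) : \bar R :=
  \int[mu]_x phi_exp (p x) `|g x|.

Definition Lp_norm p (g : 'rV[R]_n -> \bar R) : \bar R :=
  ereal_inf [set l%:E | l in
    [set l : R | (0 < l)%R /\ modular p (fun x => g x * (l^-1)%:E) <= 1]].

Definition Lp_lq_norm p q f : \bar R :=
  Lp_norm p (fun x => 'N[counting]_(q x)[f ^~ x]).

Definition lq_Lp_modular p q f : \bar R :=
  \sum_(j <oo) ereal_inf [set l%:E | l in [set l : R | (0 < l)%R /\
    modular p (fun x => f j x * ((l `^ fine ((q x)^-1)%E)^-1)%R%:E) <= 1]].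

Definition lq_Lp_norm p q f : \bar R :=
  ereal_inf [set m%:E | m in [set m : R | (0 < m)%R /\
    lq_Lp_modular p q (fun j x => f j x * (m^-1)%:E) <= 1]].

Definition mem_lr_Linfty (r : \bar R) (u : nat -> 'rV[R]_n -> R) :=
  'N[counting]_r[(fun j => 'N[mu]_+oo[EFin \o u j])] < +oo.

Definition mem_Linfty_lr (r : \bar R) (u : nat -> 'rV[R]_n -> R) :=
  'N[mu]_+oo[(fun x => 'N[counting]_r[(fun j => (u j x)%:E)])] < +oo.

(* The q* with 1 / q* = (1 / q1^- - 1 / q0^+)_+ ; in \bar R the inverse of +oo
   is 0 and the inverse of 0 is +oo. *)
Definition qstar q0 q1 : \bar R :=
  (maxe ((ess_inf mu q1)^-1 - (ess_sup mu q0)^-1) 0)^-1.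

End exponent.

Section spaces.
Context (R : realType) (n : nat).

Definition weight (alpha alpha1 alpha2 : R) (w : nat -> 'rV[R]_n -> R) :=
  [/\ forall j, measurable_fun [set: Rn R n] (w j),
      exists2 c : R, 0 < c & forall j x y,
        0 < w j x <= c * w j y * (1 + 2 ^+ j * enorm (x - y)) `^ alpha &
      forall j x, 2 `^ alpha1 * w j x <= w j.+1 x <= 2 `^ alpha2 * w j x].

Variables (phi Phi : schwartz R n).

Definition weighted_pieces (w : nat -> 'rV[R]_n -> R) (T : tempered R n) :
    nat -> 'rV[R]_n -> \bar R := fun j x =>
  (normc ((w j x)%:C * convolution (dyadic phi Phi j) T x))%:E.

Definition B_norm (w : nat -> 'rV[R]_n -> R) (p q : 'rV[R]_n -> \bar R)
    (T : tempered R n) : \bar R :=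
  lq_Lp_norm p q (weighted_pieces w T).

Definition F_norm (w : nat -> 'rV[R]_n -> R) (p q : 'rV[R]_n -> \bar R)
    (T : tempered R n) : \bar R :=
  Lp_lq_norm p q (weighted_pieces w T).

End spaces.

Section embedding.
Context (R : realType) (n : nat).
Implicit Types N : tempered R n -> \bar R.

Definition space_of N : set (tempered R n) := [set T | (N T < +oo)%E].

(* Continuity of the inclusion, a linear map between quasi-normed spaces. *)
Definition embedded N0 N1 := space_of N0 `<=` space_of N1 /\
  exists2 C : R, 0 < C & forall T, space_of N0 T -> (N1 T <= C%:E * N0 T)%E.

End embedding.

(* Main.v *)
Require Import Defs.
From mathcomp.real_closed Require complex.
From mathcomp Require finmap.
From mathcomp Require Import all_boot all_order all_algebra.
From mathcomp Require Import all_classical all_reals all_analysis.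
From mathcomp Require Import measurable_realfun ess_sup_inf.
From mathcomp Require Import ring lra.
Import Order.TTheory GRing.Theory Num.Theory.
Import numFieldNormedType.Exports.

Local Open Scope ring_scope.

(** Write [t = 1/q1], [s = 1/q0], [r = 1/q*] and [u_j = v_j / w_j].  The two
    families of dyadic pieces differ by the factor [u_j], and almost everywhere
    [t(x) <= 1/q1^- <= r + 1/q0^+ <= r + s(x)]; everything else follows from
    this inequality between exponents.

    The substitute for Hoelder's inequality is a normal form of the norm of a
    sequence: for every exponent [q] in ]0, oo], the l_q norm of [f] is at most
    [B] if and only if [|f_j| <= B * c_j^(1/q)] for a profile [c], that is, a
    nonnegative sequence of sum at most 1 (lemma [lnorm_le_profileP]).  The case
    [q = oo] is not exceptional, as [c_j^0 = 1].  If [c] and [d] are profiles,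
    so is their mean, and [c_j^r d_j^s <= 2^(r+s) ((c_j + d_j)/2)^t] as soon as
    [t <= r + s], the mean being at most 1 ([powR_mul_le_mean]).  Hence a
    multiplier with profile [c] acts between the two scales of norms, with a
    constant depending on [s] only through an upper bound, namely [1/q0^-].

    For F this is applied at almost every point [x]: there [c] is a profile of
    [u(x)] and [d] one of the pieces at [x] ([lnorm_mul_le]).  For B, [c] is a
    profile of the sequence of essential suprema of the [u_j], and [d_j] is half
    of an admissible [lambda_j] in the modular of l_q(L_p), chosen close enough
    to the infimum for the [lambda_j] to have sum at most 2; the mean of [c]
    and [d] then provides the numbers [lambda_j] for the target space
    ([lq_Lp_norm_mul_le]).

    The modulars of the two families are compared although their integrands are
    not known to be measurable: the integral of a nonnegative function is
    a supremum over the simple functions below it, so that it is monotone, up to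
    null sets, on arbitrary nonnegative functions ([ge0_ae_le_integralT]). *)

Set Implicit Arguments.
Unset Strict Implicit.
Unset Printing Implicit Defensive.

(** * Profiles of sequences *)

(** Both [c] and [d] are at most [c + d]; doubling the mean costs [2^(r+s)], and
    lowering the exponent of the mean from [r + s] to [t] is free because the
    mean is at most 1. *)
Lemma powR_mul_le_mean (R : realType) (c d r s t : R) :
  0 <= c <= 1 -> 0 <= d <= 1 -> 0 <= r -> 0 <= s -> 0 <= t -> t <= r + s ->
  c `^ r * d `^ s <= 2 `^ (r + s) * ((c + d) / 2) `^ t.
Proof.
move=> /andP[c0 c1] /andP[d0 d1] r0 s0 t0 trs.
have m0 : 0 <= (c + d) / 2 by lra.
have m1 : (c + d) / 2 <= 1 by lra.
apply: (@le_trans _ _ ((c + d) `^ r * (c + d) `^ s)).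
  by apply: ler_pM; rewrite ?powR_ge0//; apply: ge0_ler_powR;
    rewrite ?nnegrE//; lra.
apply: (@le_trans _ _ (2 `^ (r + s) * ((c + d) / 2) `^ (r + s))).
  rewrite -(powRM _ (ler0n _ 2) m0).
  rewrite [X in X `^ (r + s)](_ : _ = c + d); last by field.
  (* The law of exponents holds at base 0 when r + s is not 0; otherwise both
     exponents vanish. *)
  have [rs|rs] := eqVneq (r + s) 0.
    have -> : r = 0 by lra.
    have -> : s = 0 by lra.
    by rewrite addr0 !powRr0 mulr1.
  by rewrite powRD// (negbTE rs).
apply: ler_wpM2l; first exact: powR_ge0.
have [->|m_neq0] := eqVneq ((c + d) / 2) 0; last first.
  by apply: ger_powR; rewrite // m1 andbT lt_neqAle eq_sym m_neq0.
have [rs|rs] := eqVneq (r + s) 0; last by rewrite powR0// powR_ge0.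
have -> : t = 0 by lra.
by rewrite rs.
Qed.

Section profiles.
Local Open Scope classical_set_scope.
Local Open Scope ereal_scope.

Lemma ae_counting_forall (R : realType) (P : set nat) :
  {ae (@counting nat R), forall j, P j} -> forall j, P j.
Proof.
move=> [N [_ N0 PN]] j; apply: contrapT => /PN Nj.
suff : (0 : \bar R) < counting N by rewrite N0 ltxx.
apply: (@lt_le_trans _ _ (counting [set j])).
  by rewrite /counting asboolT// fset_set1 finmap.cardfs1 lte_fin.
by apply: le_measure; rewrite ?inE// => _ ->.
Qed.

Lemma nneseries_term_le (R : realType) (c : nat -> \bar R) (b : \bar R) :
  (forall j, 0 <= c j) -> \sum_(j <oo) c j <= b -> forall j, c j <= b.
Proof.
move=> c0 cb j; apply: le_trans cb.
rewrite (nneseriesD1 (n := j))//.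
by rewrite leeDl// nneseries_ge0.
Qed.

Lemma ge0_le_poweR (R : realType) (r : R) (x y : \bar R) :
  (0 <= r)%R -> 0 <= x -> x <= y -> x `^ r <= y `^ r.
Proof.
move=> r0 x0 xy; apply: gt0_ler_poweR => //; rewrite in_itv/= leey ?x0//.
by rewrite (le_trans x0 xy).
Qed.

Lemma fine_inve_ge0 (R : realType) (q : \bar R) : 0 < q -> (0 <= fine q^-1)%R.
Proof. by move=> q0; rewrite fine_ge0// inve_ge0 ltW. Qed.

Lemma inve_fin_num (R : realType) (q : \bar R) : 0 < q -> q^-1 \is a fin_num.
Proof.
move=> q0; rewrite fin_numE inve_eqy (gt_eqF q0) andbT gt_eqF//.
by rewrite (lt_le_trans ltNy0)// inve_ge0 ltW.
Qed.

Lemma le_fine_inve (R : realType) (a b : \bar R) : 0 < a -> a <= b ->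
  (fine b^-1 <= fine a^-1)%R.
Proof.
move=> a0 ab; have b0 : 0 < b by exact: lt_le_trans ab.
by rewrite fine_le ?inve_fin_num// lee_pV2// inE /= ltW.
Qed.

(** For finite [q] the profile of [f] is [(|f_j| / B)^q], whose sum is at most 1
    exactly when the norm is at most [B].  For [q = oo] the exponent of [c_j]
    is 0 and any profile will do. *)
Lemma lnorm_le_profileP (R : realType) (q : \bar R) (f : nat -> \bar R) (B : R) :
  0 < q -> (0 < B)%R ->
  'N[counting]_q[f] <= B%:E <->
  exists c : nat -> R, [/\ forall j, (0 <= c j)%R,
    \sum_(j <oo) (c j)%:E <= 1 &
    forall j, `|f j| <= (B * c j `^ fine q^-1)%:E].
Proof.
case: q => [r| |]// r0 B0; last first.
  rewrite unlock ifT; last first.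
    apply: (@lt_le_trans _ _ (counting [set 0%N])).
      by rewrite /counting asboolT// fset_set1 finmap.cardfs1 lte_fin.
    by apply: le_measure; rewrite ?inE.
  split=> [/ess_supP/ae_counting_forall/= fB|[c [_ _ fc]]].
    exists (fun=> 0%R); split=> // [|j]; first by rewrite eseries0.
    by rewrite ?invey/= powRr0 mulr1.
  apply/ess_supP/nearW => j/=; have := fc j.
  by rewrite ?invey/= powRr0 mulr1.
have B0' := ltW B0; rewrite lte_fin in r0; rewrite Lnorm_counting// inver gt_eqF//=.
have Br0 : (0 < B `^ r)%R by rewrite powR_gt0.
have rr : (r * r^-1 = 1)%R by rewrite divff// gt_eqF.
have fr0 j : 0 <= `|f j| `^ r by exact: poweR_ge0.
split=> [fB|[c [c0 c1 fc]]]; last first.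
  apply: (@le_trans _ _ ((B `^ r)%:E `^ r^-1)); last first.
    by rewrite poweR_EFin -powRrM rr powRr1.
  apply: ge0_le_poweR; [by rewrite invr_ge0 ltW|exact: nneseries_ge0|].
  rewrite -[leRHS]mule1; apply: le_trans (lee_wpmul2l _ c1); last first.
    by rewrite lee_fin ltW.
  rewrite -nneseriesZl//; last by move=> j _; rewrite lee_fin.
  apply: lee_nneseries => // j _; rewrite -EFinM.
  apply: (@le_trans _ _ ((B * c j `^ r^-1)%:E `^ r)).
    by apply: ge0_le_poweR; [exact: ltW| |exact: fc].
  rewrite poweR_EFin lee_fin powRM ?powR_ge0//.
  by rewrite -powRrM (mulrC r^-1%R) rr powRr1.
have fBr : \sum_(j <oo) `|f j| `^ r <= (B `^ r)%:E.
  rewrite -[leLHS]poweRe1 ?nneseries_ge0// -rr mulrC poweRrM -poweR_EFin.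
  by apply: ge0_le_poweR; [exact: ltW|exact: poweR_ge0|].
have ffin j : `|f j| \is a fin_num.
  rewrite ge0_fin_numE//; apply: (@lty_poweRy _ _ r); first by rewrite gt_eqF.
  by apply: le_lt_trans (nneseries_term_le fr0 fBr j) _; rewrite ltry.
exists (fun j => (fine `|f j| / B) `^ r)%R; split=> [j||j].
- exact: powR_ge0.
- rewrite (eq_eseriesr (g := fun j => (B `^ r)^-1%:E * `|f j| `^ r)); last first.
    move=> j _; rewrite -[in RHS](fineK (ffin j)) poweR_EFin -EFinM.
    rewrite powRM ?fine_ge0 ?invr_ge0// mulrC.
    by rewrite -powR_inv1// powRAC powR_inv1 ?powR_ge0.
  rewrite nneseriesZl// lee_pdivrMl// mule1//.
- rewrite -powRrM rr powRr1 ?divr_ge0 ?fine_ge0//.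
  by rewrite mulrC divfK ?gt_eqF// fineK.
Qed.

Lemma nneseries_mean_le1 (R : realType) (c d : nat -> R) :
  (forall j, 0 <= c j)%R -> (forall j, 0 <= d j)%R ->
  \sum_(j <oo) (c j)%:E <= 1 -> \sum_(j <oo) (d j)%:E <= 1 ->
  \sum_(j <oo) ((c j + d j) / 2)%:E <= 1.
Proof.
move=> c0 d0 c1 d1.
rewrite (eq_eseriesr (g := fun j => 2^-1%:E * ((c j)%:E + (d j)%:E))); last first.
  by move=> j _; rewrite -EFinD -EFinM mulrC.
rewrite nneseriesZl//; last by move=> j _; rewrite -EFinD lee_fin addr_ge0.
rewrite nneseriesD//; try by move=> j _ _; rewrite lee_fin.
by rewrite lee_pdivrMl// mule1 (_ : 2%:E = 1 + 1 :> \bar R) ?leeD.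
Qed.

Lemma profile_mul_le (R : realType) (c d : nat -> R) (r s S t : R) :
  (forall j, 0 <= c j)%R -> (forall j, 0 <= d j)%R ->
  \sum_(j <oo) (c j)%:E <= 1 -> \sum_(j <oo) (d j)%:E <= 1 ->
  (0 <= r)%R -> (0 <= s)%R -> (s <= S)%R -> (0 <= t)%R -> (t <= r + s)%R ->
  forall j, (c j `^ r * d j `^ s <= 2 `^ (r + S) * ((c j + d j) / 2) `^ t)%R.
Proof.
move=> c0 d0 c1 d1 r0 s0 sS t0 trs j.
have cj1 : (c j <= 1)%R.
  by rewrite -lee_fin; exact: (nneseries_term_le (c := EFin \o c) c0 c1 j).
have dj1 : (d j <= 1)%R.
  by rewrite -lee_fin; exact: (nneseries_term_le (c := EFin \o d) d0 d1 j).
apply: le_trans (powR_mul_le_mean (t := t) _ _ r0 s0 _ _) _;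
  rewrite ?c0 ?d0//.
by rewrite ler_wpM2r ?powR_ge0// ler_powR ?lerD2l ?ler1n.
Qed.

(** The inequality of Hoelder, weakened to an inequality between the exponents
    and up to a constant.  That constant is uniform in [q0] and [q1] as long as
    [1/q0 <= S], so that it survives when the exponents vary with the point. *)
Lemma lnorm_mul_le (R : realType) (a q0 q1 : \bar R) (u f g : nat -> \bar R)
    (A S : R) :
  0 < a -> 0 < q0 -> 0 < q1 -> (0 < A)%R ->
  (fine q0^-1 <= S)%R -> (fine q1^-1 <= fine a^-1 + fine q0^-1)%R ->
  'N[counting]_a[u] <= A%:E -> (forall j, `|g j| <= `|u j| * `|f j|) ->
  'N[counting]_q1[g] <= (A * 2 `^ (fine a^-1 + S))%:E * 'N[counting]_q0[f].
Proof.
move=> a0 q00 q10 A0 sS trs uA guf.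
set K := (A * _)%R; have K0 : (0 < K)%R by rewrite mulr_gt0 ?powR_gt0.
(* A bound strictly above the norm of f is positive, even if f vanishes. *)
rewrite -lee_pdivrMl//; apply/lee_addgt0Pr => e e0.
have := Lnorm_ge0 counting q0 f; case E : ('N[_]_q0[f]) => [b| |]// b0; last first.
  by rewrite addye// leey.
rewrite lee_fin in b0; rewrite lee_pdivrMl// -EFinD -EFinM.
have B0 : (0 < b + e)%R by lra.
have [c [c0 c1 uc]] := (lnorm_le_profileP u a0 A0).1 uA.
have [|d [d0 d1 fd]] := (lnorm_le_profileP f q00 B0).1.
  by rewrite E lee_fin lerDl ltW.
apply/lnorm_le_profileP => //; first by rewrite mulr_gt0.
exists (fun j => (c j + d j) / 2)%R; split.
- by move=> j; rewrite divr_ge0// addr_ge0.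
- exact: nneseries_mean_le1.
move=> j; apply: le_trans (guf j) _.
apply: le_trans (lee_pmul _ _ (uc j) (fd j)) _ => //.
rewrite -EFinM lee_fin.
have := profile_mul_le c0 d0 c1 d1 (fine_inve_ge0 a0) (fine_inve_ge0 q00) sS
  (fine_inve_ge0 q10) trs j.
move=> /(ler_wpM2l (mulr_ge0 (ltW A0) (ltW B0))).
by rewrite /K mulrACA => /le_trans; apply; rewrite le_eqVlt; apply/orP; left;
  apply/eqP; ring.
Qed.

End profiles.

(** * Monotonicity of the integral without measurability *)

Section monotonicity.
Local Open Scope classical_set_scope.
Local Open Scope ereal_scope.
Import HBNNSimple.

(** A simple function below [f] lies below [g] once it is set to 0 on a
    measurable null set, and this does not change its integral. *)
Lemma ge0_ae_le_integralT d (T : measurableType d) (R : realType)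
    (mu : {measure set T -> \bar R}) (f g : T -> \bar R) :
  (forall x, 0 <= f x) -> (forall x, 0 <= g x) ->
  {ae mu, forall x, f x <= g x} -> \int[mu]_x f x <= \int[mu]_x g x.
Proof.
move=> f0 g0 [N [mN N0 fgN]]; rewrite !ge0_integralTE//.
apply: ge_ereal_sup => _ [h /= hf <-].
pose h' := proj_nnsfun h (measurableC mN).
apply: (@le_trans _ _ (sintegral mu h')); last first.
  apply: ereal_sup_ubound; exists h' => //= x.
  rewrite /h' /= mindicE; have [xN|xN] := boolP (x \in ~` N).
    rewrite mulr1; apply: le_trans (hf x) _; apply: contrapT => fg.
    by move: xN; rewrite inE => /(_ (fgN _ fg)).
  by rewrite mulr0.
rewrite -!integralT_nnsfun; apply: ae_ge0_le_integral => //.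
- by move=> x _; rewrite lee_fin.
- exact/measurable_EFinP.
- by move=> x _; rewrite lee_fin.
- exact/measurable_EFinP.
exists N; split => // x /= hh; apply: contrapT => xN; apply: hh => _.
by rewrite mindicE mem_set// mulr1.
Qed.

End monotonicity.

(** * Exponents and modulars *)

Section norms.
Local Open Scope classical_set_scope.
Local Open Scope ereal_scope.

Lemma lebesgue_tuple_gt0 (R : realType) (n : nat) : 0 < lebesgue_tuple R n setT.
Proof.
elim: n => [|n IH] /=; first by rewrite diracT.
have -> : lebesgue_tupleS (lebesgue_tuple R n) setT =
    (lebesgue_tuple R n \x (@lebesgue_measure R))%E (setT `*` setT).
  by rewrite setXTT /lebesgue_tupleS /pushforward preimage_setT.
rewrite product_measure1E//.
apply: mule_gt0 => //.
apply: (@lt_le_trans _ _ (lebesgue_measure (`[0%R, 1%R]%classic : set R))).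
  by rewrite lebesgue_measure_itv/= lte_fin ltr01 sube0 lte_fin.
by apply: le_measure; rewrite ?inE.
Qed.

(** An essential infimum is below an essential supremum only on a space that is
    not null; this is what makes the essential supremum of an exponent positive. *)
Lemma lebesgue_gt0 (R : realType) (n : nat) : 0 < lebesgue R n setT.
Proof.
rewrite /lebesgue measurable_mu_extE//=.
by rewrite /lebesgue_borel /pushforward preimage_setT lebesgue_tuple_gt0.
Qed.

Context (R : realType) (n : nat).
Local Notation mu := (lebesgue R n).
Implicit Types p q : 'rV[R]_n -> \bar R.

Lemma exponent_inve_bounded q : exponent q -> exists S : R,
  {ae mu, forall x : Rn R n, (fine (q x)^-1 <= S)%R}.
Proof.
case=> _ _ q_inf; exists (fine (ess_inf mu q)^-1).
by apply: filterS (ess_inf_le mu q) => x; exact: le_fine_inve.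
Qed.

(** The only facts about [qstar] that matter: with [r] its inverse, almost
    everywhere [1/q1 <= 1/q1^- <= r + 1/q0^+ <= r + 1/q0]. *)
Lemma qstarV q0 q1 : exponent q0 -> exponent q1 ->
  exists2 r : R, (0 <= r)%R & [/\ 0 < qstar q0 q1, (qstar q0 q1)^-1 = r%:E &
    {ae mu, forall x : Rn R n, (fine (q1 x)^-1 <= r + fine (q0 x)^-1)%R}].
Proof.
move=> [_ q0_gt0 q0_inf] [_ _ q1_inf].
have q0_sup : 0 < ess_sup mu q0.
  apply: lt_le_trans q0_inf _; apply: ess_sup_gee; last exact: ess_inf_le.
  exact: lebesgue_gt0.
have aE := fineK (inve_fin_num q1_inf); have bE := fineK (inve_fin_num q0_sup).
set a := fine _ in aE; set b := fine _ in bE.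
have qE : (qstar q0 q1)^-1 = (Num.max (a - b) 0)%R%:E.
  by rewrite /qstar inveK -aE -bE -EFinB -EFin_max.
exists (Num.max (a - b) 0)%R; first by rewrite le_max lexx orbT.
split => //.
  rewrite lt_neqAle eq_sym -[X in X != _]inveK inve_eq0 qE andTb.
  by rewrite -inve_ge0 qE lee_fin le_max lexx orbT.
apply: filterS2 (ess_inf_le mu q1) (ess_sup_ge mu q0) => x q1x q0x.
have := le_fine_inve q1_inf q1x; have := le_fine_inve (q0_gt0 x) q0x.
rewrite -/a -/b; have : (a - b <= Num.max (a - b) 0)%R by rewrite le_max lexx.
lra.
Qed.

Lemma phi_exp_ge0 (r t : \bar R) : 0 <= phi_exp r t.
Proof. by case: r => [r| |]//=; [exact: poweR_ge0|case: ifP]. Qed.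

Lemma le_phi_exp (r s t : \bar R) : 0 < r -> 0 <= s -> s <= t ->
  phi_exp r s <= phi_exp r t.
Proof.
case: r => [r| |]//= r0 s0 st; first by apply: ge0_le_poweR => //; exact: ltW.
by case: ifPn => [s1|s1]; case: ifPn => // t1; rewrite (le_trans st t1) in s1.
Qed.

Lemma ae_le_modular p (f g : 'rV[R]_n -> \bar R) : (forall x, 0 < p x) ->
  {ae mu, forall x : Rn R n, `|f x| <= `|g x|} -> modular p f <= modular p g.
Proof.
move=> p0 fg; apply: ge0_ae_le_integralT.
- by move=> x; exact: phi_exp_ge0.
- by move=> x; exact: phi_exp_ge0.
by apply: filterS fg => x; apply: le_phi_exp.
Qed.

(** All the norms are infima of this shape, so that it suffices to transfer
    admissible constants from one modular to the other. *)
Lemma ereal_inf_le_scale (K : R) (P Q : set R) : (0 < K)%R ->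
  (forall m, (0 < m)%R -> P m -> Q (K * m)%R) ->
  ereal_inf [set m%:E | m in [set m | (0 < m)%R /\ Q m]] <=
  K%:E * ereal_inf [set m%:E | m in [set m | (0 < m)%R /\ P m]].
Proof.
move=> K0 PQ; rewrite -lee_pdivrMl//; apply: le_ereal_inf_tmp => _ [m [m0 Pm] <-].
rewrite lee_pdivrMl// -EFinM; apply: ereal_inf_lbound.
by exists (K * m)%R => //; split; [rewrite mulr_gt0|exact: PQ].
Qed.

Lemma ge0_abseMr (x : \bar R) (k : R) : (0 <= k)%R ->
  `|x * k%:E| = `|x| * k%:E.
Proof. by move=> k0; rewrite abseM abse_EFin ger0_norm. Qed.

Lemma Lp_norm_le p (f g : 'rV[R]_n -> \bar R) (K : R) :
  (forall x, 0 < p x) -> (0 < K)%R ->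
  {ae mu, forall x : Rn R n, `|g x| <= K%:E * `|f x|} ->
  Lp_norm p g <= K%:E * Lp_norm p f.
Proof.
move=> p0 K0 gf; apply: ereal_inf_le_scale => // m m0; apply: le_trans.
apply: ae_le_modular => //; apply: filterS gf => x gfx.
rewrite !ge0_abseMr ?invr_ge0 ?mulr_ge0 ?(ltW m0) ?(ltW K0)//.
rewrite invfM EFinM muleA lee_pmul2r ?lte_fin ?invr_gt0//.
by rewrite lee_pdivrMr// muleC.
Qed.

(** * Multipliers between the mixed norms *)

(** The sum of the infima in the modular is at most 1.  Exceeding the [j]-th one
    by at most [2^-(j+1)] gives admissible numbers of sum at most 2, and [d] is
    half of them. *)
Lemma lq_Lp_modular_adherent p q (f : nat -> 'rV[R]_n -> \bar R) :
  lq_Lp_modular p q f <= 1 ->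
  exists d : nat -> R, [/\ forall j, (0 < d j)%R, \sum_(j <oo) (d j)%:E <= 1 &
    forall j, modular p (fun x =>
      f j x * (((2 * d j) `^ fine (q x)^-1)^-1)%:E) <= 1].
Proof.
rewrite /lq_Lp_modular; set lam := (X in \sum_(j <oo) X j) => lam1.
have lam0 j : 0 <= lam j.
  by apply: le_ereal_inf_tmp => _ [l [l0 _] <-]; rewrite lee_fin ltW.
have lam_fin j : lam j \is a fin_num.
  rewrite ge0_fin_numE//.
  by apply: le_lt_trans (nneseries_term_le lam0 lam1 j) _; rewrite ltry.
have /choice[l lP] j : exists l : R, [/\ (0 < l)%R, modular p (fun x =>
    f j x * ((l `^ fine (q x)^-1)^-1)%:E) <= 1 &
    l%:E <= lam j + (1 / (2 ^ j.+1)%:R)%:E].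
  have e0 : (0 < 1 / (2 ^ j.+1)%:R :> R)%R by rewrite divr_gt0// ltr0n expn_gt0.
  have [_ [l [l0 lm] <-] /ltW llam] := lb_ereal_inf_adherent e0 (lam_fin j).
  by exists l.
exists (fun j => l j / 2)%R; split=> [j||j].
- by have [l0 _ _] := lP j; rewrite divr_gt0.
- rewrite (eq_eseriesr (g := fun j => 2^-1%:E * (l j)%:E)); last first.
    by move=> j _; rewrite -EFinM mulrC.
  rewrite nneseriesZl//; last by move=> j _; have [/ltW l0 _ _] := lP j.
  rewrite lee_pdivrMl// mule1.
  apply: (@le_trans _ _ (\sum_(j <oo) (lam j + (1 / (2 ^ j.+1)%:R)%:E))).
    by apply: lee_nneseries => j _; have [/ltW l0 _ ll] := lP j.
  apply: le_trans (epsilon_trick _ lam0 ler01) _.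
  by rewrite (_ : 2%:E = 1 + 1 :> \bar R) ?leeD.
by rewrite (mulrC 2%R) divfK//; have [_ + _] := lP j.
Qed.

(** If [2 d_j] is admissible for [f_j / m] in the source modular, then the mean
    of [c_j] and [d_j] is admissible for [g_j / (K m)] in the target modular.
    The factor [2^S] pays for the 2 in front of [d_j]. *)
Lemma lq_Lp_norm_mul_le p q0 q1 (r S A : R) (c : nat -> R)
    (f g : nat -> 'rV[R]_n -> \bar R) :
  (forall x, 0 < p x) -> (forall x, 0 < q0 x) -> (forall x, 0 < q1 x) ->
  (0 <= r)%R -> (0 < A)%R ->
  {ae mu, forall x : Rn R n, (fine (q0 x)^-1 <= S)%R} ->
  {ae mu, forall x : Rn R n, (fine (q1 x)^-1 <= r + fine (q0 x)^-1)%R} ->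
  (forall j, 0 <= c j)%R -> \sum_(j <oo) (c j)%:E <= 1 ->
  (forall j,
    {ae mu, forall x : Rn R n, `|g j x| <= (A * c j `^ r)%:E * `|f j x|}) ->
  lq_Lp_norm p q1 g <= (A * 2 `^ (r + S) * 2 `^ S)%:E * lq_Lp_norm p q0 f.
Proof.
move=> p0 q00 q10 r0 A0 sS trs c0 c1 gf.
set K := (A * _ * _)%R; have K0 : (0 < K)%R by rewrite !mulr_gt0 ?powR_gt0.
rewrite /lq_Lp_norm; refine (ereal_inf_le_scale (K := K)
  (P := fun m => lq_Lp_modular p q0 (fun j x => f j x * (m^-1)%:E) <= 1)
  (Q := fun m => lq_Lp_modular p q1 (fun j x => g j x * (m^-1)%:E) <= 1) K0 _).
move=> m m0 /lq_Lp_modular_adherent[d [d0 d1 fd]].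
have d0' j : (0 <= d j)%R by exact: ltW.
apply: le_trans (nneseries_mean_le1 c0 d0' c1 d1); apply: lee_nneseries.
  by move=> j _ _; apply: le_ereal_inf_tmp => _ [l [l0 _] <-]; rewrite lee_fin ltW.
move=> j _; apply: ereal_inf_lbound; set sigma := ((c j + d j) / 2)%R.
have sigma0 : (0 < sigma)%R by rewrite divr_gt0// ltr_wpDl.
exists sigma => //; split=> //; apply: le_trans (fd j).
apply: ae_le_modular => //; apply: filterS3 sS trs (gf j) => x sS trs gfx.
have s0 := fine_inve_ge0 (q00 x); have t0 := fine_inve_ge0 (q10 x).
move: (fine (q0 x)^-1) (fine (q1 x)^-1) s0 t0 sS trs => s t s0 t0 sS trs.
have st : (A * c j `^ r * (2 * d j) `^ s <= K * sigma `^ t)%R.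
  rewrite powRM// /K.
  have H1 := profile_mul_le c0 d0' c1 d1 r0 s0 sS t0 trs j.
  have H2 : (2 `^ s <= 2 `^ S :> R)%R by apply: ler_powR; rewrite ?ler1n.
  have := ler_pM _ _ H1 H2; rewrite !mulr_ge0 ?powR_ge0// => /(_ isT isT).
  move=> /(ler_wpM2l (ltW A0)); rewrite -/sigma; lra.
have ds0 : (0 < (2 * d j) `^ s)%R by apply: powR_gt0; rewrite mulr_gt0.
have st0 : (0 < sigma `^ t)%R by rewrite powR_gt0.
have coef : (A * c j `^ r * ((K * m)^-1 / sigma `^ t) <=
    m^-1 / (2 * d j) `^ s)%R.
  rewrite (_ : (A * c j `^ r * ((K * m)^-1 / sigma `^ t))%R =
    (m^-1 / (2 * d j) `^ s *
     (A * c j `^ r * (2 * d j) `^ s / (K * sigma `^ t)))%R); last first.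
    by field; rewrite !gt_eqF.
  apply: ler_piMr; first by rewrite divr_ge0 ?invr_ge0 ?ltW.
  by rewrite ler_pdivrMr ?mul1r// mulr_gt0.
have Km0 : (0 <= (K * m)^-1)%R by rewrite invr_ge0 ltW// mulr_gt0.
have is0 : (0 <= (sigma `^ t)^-1)%R by rewrite invr_ge0 ltW.
have im0 : (0 <= m^-1)%R by rewrite invr_ge0 ltW.
have id0 : (0 <= ((2 * d j) `^ s)^-1)%R by rewrite invr_ge0 ltW.
rewrite !ge0_abseMr// -!muleA -!EFinM.
apply: le_trans (lee_wpmul2r _ gfx) _; first by rewrite lee_fin mulr_ge0.
by rewrite muleAC -EFinM muleC lee_wpmul2l// lee_fin.
Qed.

(** Here the multiplier is controlled at almost every point, hence so are the
    l_q norms to which the monotonicity of the outer norm applies. *)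
Lemma Lp_lq_norm_mul_le p q0 q1 (a : \bar R) (A S : R)
    (u f g : nat -> 'rV[R]_n -> \bar R) :
  (forall x, 0 < p x) -> (forall x, 0 < q0 x) -> (forall x, 0 < q1 x) ->
  0 < a -> (0 < A)%R ->
  {ae mu, forall x : Rn R n, (fine (q0 x)^-1 <= S)%R} ->
  {ae mu, forall x : Rn R n, (fine (q1 x)^-1 <= fine a^-1 + fine (q0 x)^-1)%R} ->
  {ae mu, forall x : Rn R n, 'N[counting]_a[u ^~ x] <= A%:E} ->
  (forall j x, `|g j x| <= `|u j x| * `|f j x|) ->
  Lp_lq_norm p q1 g <= (A * 2 `^ (fine a^-1 + S))%:E * Lp_lq_norm p q0 f.
Proof.
move=> p0 q00 q10 a0 A0 sS trs uA guf.
apply: Lp_norm_le => //; first by rewrite mulr_gt0 ?powR_gt0.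
apply: filterS3 sS trs uA => x sS trs uA.
rewrite !gee0_abs ?Lnorm_ge0//; apply: (lnorm_mul_le a0 (q00 x) (q10 x) A0 sS trs uA).
by move=> j; exact: guf.
Qed.

End norms.

(** * Weighted pieces and embeddings *)

Section pieces.
Local Open Scope classical_set_scope.
Local Open Scope ereal_scope.

Lemma ltey_le_pos (R : realType) (x : \bar R) : x < +oo ->
  exists2 A : R, (0 < A)%R & x <= A%:E.
Proof.
case: x => [r| |]// _; last by exists 1%R => //; rewrite leNye.
by exists (Num.max r 1%R); rewrite ?lee_fin ?lt_max ?ltr01 ?orbT// le_max lexx.
Qed.

Lemma ae_le_Lnormy d (T : measurableType d) (R : realType)
    (mu : {measure set T -> \bar R}) (f : T -> \bar R) :
  0 < mu setT -> {ae mu, forall x, `|f x| <= 'N[mu]_+oo[f]}.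
Proof. by move=> muT; rewrite unlock muT; exact: ess_sup_ge. Qed.

Lemma embeddedW (R : realType) (n : nat) (N0 N1 : tempered R n -> \bar R) :
  (exists2 C : R, (0 < C)%R & forall T, N1 T <= C%:E * N0 T) ->
  embedded N0 N1.
Proof.
case=> C C0 N01; split; last by exists C.
move=> T; rewrite /space_of /= => N0T; apply: le_lt_trans (N01 T) _.
by case: (N0 T) N0T => [x| |]// _; rewrite -?EFinM ?ltry// gt0_muleNy ?lte_fin.
Qed.

Lemma weighted_pieces_div (R : realType) (n : nat) (phi Phi : schwartz R n)
    (w v : nat -> 'rV[R]_n -> R) (T : tempered R n) j x : (w j x != 0)%R ->
  `|weighted_pieces phi Phi v T j x| =
  `|(v j x / w j x)%:E| * `|weighted_pieces phi Phi w T j x|.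
Proof.
move=> w0; rewrite /weighted_pieces !complex.ComplexField.Normc.normcM /=.
rewrite !expr0n /= !addr0 !sqrtr_sqr.
rewrite -EFinM !normrM !normr_id mulrA; congr ((_ * _)%:E)%R.
by rewrite -!normrM divfK.
Qed.

End pieces.

Unset Implicit Arguments.

Theorem proposition5p2 (R : realType) (n : nat) (n_gt0 : (0 < n)%N)
    (phi Phi : schwartz R n) (phi_adm : admissible phi Phi)
    (alpha alpha1 alpha2 beta beta1 beta2 : R)
    (alpha_ge0 : 0 <= alpha) (beta_ge0 : 0 <= beta)
    (le_alpha : alpha1 <= alpha2) (le_beta : beta1 <= beta2)
    (w v : nat -> 'rV[R]_n -> R)
    (w_weight : weight alpha alpha1 alpha2 w)
    (v_weight : weight beta beta1 beta2 v)
    (p q0 q1 : 'rV[R]_n -> \bar R)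
    (p_exp : exponent p) (q0_exp : exponent q0) (q1_exp : exponent q1) :
  (mem_lr_Linfty (qstar q0 q1) (fun j x => v j x / w j x) ->
   embedded (B_norm phi Phi w p q0) (B_norm phi Phi v p q1)) /\
  (mem_Linfty_lr (qstar q0 q1) (fun j x => v j x / w j x) ->
   (ess_sup (lebesgue R n) p < +oo)%E ->
   (ess_sup (lebesgue R n) q0 < +oo)%E ->
   (ess_sup (lebesgue R n) q1 < +oo)%E ->
   embedded (F_norm phi Phi w p q0) (F_norm phi Phi v p q1)).
Proof.
have w_neq0 j x : w j x != 0.
  by have [_ [c _ /(_ j x x)/andP[w0 _]] _] := w_weight; rewrite gt_eqF.
have [r r0 [qs0 qsr trs]] := qstarV q0_exp q1_exp.
have [S sS] := exponent_inve_bounded q0_exp.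
have [[_ p0 _] [_ q00 _] [_ q10 _]] := And3 p_exp q0_exp q1_exp.
have muT := lebesgue_gt0 R n.
split=> [/ltey_le_pos[A A0 uA]|/ltey_le_pos[A A0 uA] _ _ _]; apply: embeddedW.
  have [c [c0 c1 uc]] := (lnorm_le_profileP _ qs0 A0).1 uA; rewrite qsr /= in uc.
  exists (A * 2 `^ (r + S) * 2 `^ S).
    by rewrite !mulr_gt0 ?powR_gt0.
  move=> T; apply: (lq_Lp_norm_mul_le p0 q00 q10 r0 A0 sS trs c0 c1) => j.
  have := ae_le_Lnormy (EFin \o (fun x : Rn R n => v j x / w j x)) muT.
  apply: filterS => x ux.
  rewrite (weighted_pieces_div _ _ v _ (w_neq0 j x))// lee_wpmul2r//.
  apply: le_trans (uc j); apply: le_trans ux _.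
  exact: lee_abs.
have rE : fine (qstar q0 q1)^-1%E = r by rewrite qsr.
rewrite -rE in trs.
exists (A * 2 `^ (fine (qstar q0 q1)^-1%E + S)).
  by rewrite mulr_gt0 ?powR_gt0.
move=> T; apply: (Lp_lq_norm_mul_le (a := qstar q0 q1)
  (u := fun j x => (v j x / w j x)%:E)) => //.
- have := ae_le_Lnormy (fun x : Rn R n =>
    'N[counting]_(qstar q0 q1)[(fun j => (v j x / w j x)%:E)])%E muT.
  apply: filterS => x ux.
  by apply: le_trans uA; apply: le_trans ux; rewrite lee_abs.
- by move=> j x; rewrite (weighted_pieces_div _ _ v _ (w_neq0 j x)).
Qed.
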